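(* Assume that the representation $W_{\mathbf{L},\mathbf{K}}$ is generic. Then $\Phi_{\mathbf{L},\mathbf{K}}\big(\mathbb{P}(W_{\mathbf{L},\mathbf{K}})\big)\subset\mathfrak{g}$ is the convex hull of the union of the images $\Phi_{k_a,l_a}\left(\mathbb{P}^{k_a}\right)$, $a=1,\ldots,r$.
   Context: $G=U(2)$, $\mathfrak{g}=\mathfrak{u}(2)$ is the space of $2\times 2$ skew-Hermitian matrices, identified with $\mathfrak{g}^\vee$ by $\langle\beta_1,\beta_2\rangle=\mathrm{trace}(\beta_1\overline{\beta}_2^t)$. For $k\ge 0$ write points of $\mathbb{C}^{k+1}$ as $Z=(z_0,\ldots,z_k)^t$ and set $F_{k,1}(Z):=\left(\sqrt{k-j+1}\,z_{j-1}\right)_{j=1}^k\in\mathbb{C}^k$, $F_{k,2}(Z):=\left(\sqrt{j}\,z_j\right)_{j=1}^k\in\mathbb{C}^k$ (these are $0$ if $k=0$). For $l\in\mathbb{Z}$ the map $\Phi_{k,l}:\mathbb{P}^k\to\mathfrak{g}$ is $$\Phi_{k,l}([Z])=\frac{\imath}{\|Z\|^2}\begin{pmatrix}\|F_{k,1}(Z)\|^2+l\|Z\|^2& F_{k,2}(Z)^t\,\overline{F_{k,1}(Z)}\\ F_{k,1}(Z)^t\,\overline{F_{k,2}(Z)}&\|F_{k,2}(Z)\|^2+l\|Z\|^2\end{pmatrix};$$ it is the moment map, with respect to twice the Fubini-Study form, of the $G$-action on $\mathbb{P}(\mathrm{Sym}^k(\mathbb{C}^2))\cong\mathbb{P}^k$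 given by $\det^{\otimes l}\otimes\mathrm{Sym}^k(\mathbb{C}^2)$ composed with the automorphism $B\mapsto(B^t)^{-1}$ of $G$. Let $r\ge 1$, $\mathbf{L}=(l_a)\in\mathbb{Z}^r$, $\mathbf{K}=(k_a)\in\mathbb{N}^r$, and $W_{\mathbf{L},\mathbf{K}}=\bigoplus_{a=1}^r\det^{\otimes l_a}\otimes\mathrm{Sym}^{k_a}(\mathbb{C}^2)\cong\bigoplus_{a=1}^r\mathbb{C}^{k_a+1}$ (composed with $B\mapsto(B^t)^{-1}$). Write $Z=(Z_a)_{a=1}^r$ with $Z_a\in\mathbb{C}^{k_a+1}$. The moment map of the $G$-action on $\mathbb{P}(W_{\mathbf{L},\mathbf{K}})$ is $$\Phi_{\mathbf{L},\mathbf{K}}([Z])=\sum_{a:\,Z_a\neq 0}\frac{\|Z_a\|^2}{\|Z\|^2}\,\Phi_{k_a,l_a}([Z_a]).$$ The representation $W_{\mathbf{L},\mathbf{K}}$ is called generic if, whenever for some $l\in\mathbb{Z}$ the pair $(l,1)$ appears in the sequence $(l_1,k_1),\ldots,(l_r,k_r)$, there are $1\le a<b\le r$ with $(l_a,k_a)=(l_b,k_b)=(l,1)$. *)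

(* Defs.v *)
From HB Require Import structures.
From mathcomp Require Import all_boot all_order all_algebra.
From mathcomp Require Import all_classical all_reals all_analysis.
From mathcomp Require Export complex.

Set Implicit Arguments.
Unset Strict Implicit.
Unset Printing Implicit Defensive.

Import Order.TTheory GRing.Theory Num.Theory.
Local Open Scope classical_set_scope.
Local Open Scope ring_scope.
Local Open Scope complex_scope.

(* The intersection of all convex sets containing A, in a real vector space. *)
Definition convex_hull (R : realType) (E : lmodType R) (A : set E) : set E :=
  smallest (@convex_set R E) A.

(* The Lie algebra u(2), as a real vector space. *)
Section LieAlgebra.
Variable R : realType.

Definition skew_hermitian_subdef : {pred 'M[R[i]]_2} :=
  fun A => map_mx conjc A^T == - A.
Definition skew_hermitian := [qualify a A | skew_hermitian_subdef A].

Lemma skew_hermitianE (A : 'M[R[i]]_2) :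
  (A \is a skew_hermitian) = (map_mx conjc A^T == - A).
Proof. by []. Qed.

Fact skew_hermitian_zmod_closed : zmod_closed skew_hermitian.
Proof.
split=> [|A B]; rewrite !skew_hermitianE.
  by rewrite trmx0 map_mx0 oppr0 eqxx.
by move=> /eqP hA /eqP hB; rewrite raddfB /= map_mxB hA hB opprK opprB addrC.
Qed.
HB.instance Definition _ :=
  GRing.isZmodClosed.Build 'M[R[i]]_2 skew_hermitian_subdef
    skew_hermitian_zmod_closed.

Lemma skew_hermitianZ (c : R) (A : 'M[R[i]]_2) :
  A \is a skew_hermitian -> c%:C *: A \is a skew_hermitian.
Proof.
rewrite !skew_hermitianE => /eqP hA; apply/eqP.
rewrite linearZ /= map_mxZ hA scalerN; congr (- (_ *: _)).
by rewrite /= oppr0.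
Qed.

Record u2 := U2 { u2_mx :> 'M[R[i]]_2 ; _ : u2_mx \is a skew_hermitian }.
HB.instance Definition _ := [isSub for u2_mx].
HB.instance Definition _ := [Choice of u2 by <:].
HB.instance Definition _ := [SubChoice_isSubZmodule of u2 by <:].

Definition u2_scale (c : R) (A : u2) : u2 := U2 (skew_hermitianZ c (valP A)).

Fact u2_scaleA c d A : u2_scale c (u2_scale d A) = u2_scale (c * d) A.
Proof. by apply: val_inj; rewrite /= scalerA rmorphM. Qed.
Fact u2_scale1 : left_id 1 u2_scale.
Proof. by move=> A; apply: val_inj; rewrite /= scale1r. Qed.
Fact u2_scaleDr : right_distributive u2_scale +%R.
Proof. by move=> c A B; apply: val_inj; rewrite /= scalerDr. Qed.
Fact u2_scaleDl A : {morph u2_scale^~ A : c d / c + d}.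
Proof. by move=> c d; apply: val_inj; rewrite /= rmorphD scalerDl. Qed.
HB.instance Definition _ :=
  GRing.Zmodule_isLmodule.Build R u2 u2_scaleA u2_scale1 u2_scaleDr u2_scaleDl.

Lemma u2_mxZ (c : R) (A : u2) : u2_mx (c *: A) = c%:C *: u2_mx A.
Proof. by []. Qed.

End LieAlgebra.

(* Points of the projective space P(V) are the lines of V; for Z != 0 the
   point [Z] is the line <[Z]>%VS. *)
Definition projective_space (K : fieldType) (V : vectType K) :
  set {vspace V} := [set L | (\dim L == 1)%N].
Arguments projective_space {K} V.

Lemma vline_projective (K : fieldType) (V : vectType K) (v : V) :
  v != 0 -> projective_space V <[v]>%VS.
Proof. by move=> v0; rewrite /projective_space /= dim_vline v0. Qed.

Section MomentMap.
Variable R : realType.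
Local Notation C := R[i].

Definition normsq n (Z : 'cV[C]_n) : R := \sum_i Normc.normc (Z i 0) ^+ 2.

(* Indices are shifted by one: j : 'I_k stands for j + 1 in 1..k. *)
Definition F1 k (Z : 'cV[C]_k.+1) : 'cV[C]_k :=
  \col_(j < k) ((Num.sqrt (k - j)%:R)%:C * Z (widen_ord (leqnSn k) j) 0).

Definition F2 k (Z : 'cV[C]_k.+1) : 'cV[C]_k :=
  \col_(j < k) ((Num.sqrt j.+1%:R)%:C * Z (lift ord0 j) 0).

Definition moment_mx k (l : int) (Z : 'cV[C]_k.+1) : 'M[C]_2 :=
  ('i / (normsq Z)%:C) *:
    (block_mx (normsq (F1 Z) + l%:~R * normsq Z)%:C%:M
              ((F2 Z)^T *m map_mx conjc (F1 Z))
              ((F1 Z)^T *m map_mx conjc (F2 Z))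
              (normsq (F2 Z) + l%:~R * normsq Z)%:C%:M : 'M[C]_(1 + 1)).

Fact block_mx_hermitian (a b : R) (X Y : 'M[C]_1) :
  map_mx conjc X^T = Y -> map_mx conjc Y^T = X ->
  let A : 'M[C]_(1 + 1) := block_mx a%:C%:M X Y b%:C%:M in
  map_mx conjc A^T = A.
Proof.
move=> XY YX /=.
by rewrite tr_block_mx map_block_mx XY YX !tr_scalar_mx !map_scalar_mx /= oppr0.
Qed.

Fact moment_mx_skew k l (Z : 'cV[C]_k.+1) :
  moment_mx l Z \is a @skew_hermitian R.
Proof.
rewrite skew_hermitianE /moment_mx; set c := 'i / _.
have cc : c^* = - c.
  by rewrite /c -fmorphV rmorphM /= oppr0; apply/eqP; rewrite eq_complex /=;
     rewrite !(mul0r, mulr0, oppr0, addr0, subr0, add0r, mul1r, mulrN, mulN1r) !eqxx.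
rewrite linearZ /= map_mxZ [X in X *: _]cc scaleNr; apply/eqP; congr (- (_ *: _)).
have cK n (A : 'cV[C]_n) : map_mx conjc (map_mx conjc A) = A.
  by apply/matrixP => i j; rewrite !mxE conjcK.
by apply: block_mx_hermitian; rewrite trmx_mul map_mxM /= trmxK -map_trmx [X in X^T *m _]cK.
Qed.

Definition moment_vec k l (Z : 'cV[C]_k.+1) : u2 R := U2 (moment_mx_skew l Z).

(* The map is defined on lines through the representative vpick L;
   momentE shows that every nonzero representative gives the same value. *)
Definition moment k (l : int) (L : {vspace 'cV[C]_k.+1}) : u2 R :=
  moment_vec l (vpick L).

Definition moment_sum_vec r (l : 'I_r -> int) (k : 'I_r -> nat)
    (Z : 'cV[C]_(\sum_(a < r) (k a).+1)) : u2 R :=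
  \sum_(a < r | submxcol Z a != 0)
    (normsq (submxcol Z a) / normsq Z) *: moment (l a) <[submxcol Z a]>%VS.

Definition moment_sum r (l : 'I_r -> int) (k : 'I_r -> nat)
    (L : {vspace 'cV[C]_(\sum_(a < r) (k a).+1)}) : u2 R :=
  moment_sum_vec l (vpick L).

Lemma normsqZ n (c : C) (Z : 'cV[C]_n) :
  normsq (c *: Z) = Normc.normc c ^+ 2 * normsq Z.
Proof.
rewrite /normsq mulr_sumr; apply: eq_bigr => i _.
by rewrite mxE Normc.normcM exprMn.
Qed.

Lemma normc_neq0 (c : C) : c != 0 -> Normc.normc c != 0.
Proof. by apply: contra_neq; exact: Normc.eq0_normc. Qed.

Lemma F1Z k c (Z : 'cV[C]_k.+1) : F1 (c *: Z) = c *: F1 Z.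
Proof. by apply/matrixP => i j; rewrite !mxE mulrCA. Qed.

Lemma F2Z k c (Z : 'cV[C]_k.+1) : F2 (c *: Z) = c *: F2 Z.
Proof. by apply/matrixP => i j; rewrite !mxE mulrCA. Qed.

Lemma normcsqE (c : C) : (Normc.normc c ^+ 2)%:C = c * c^*.
Proof.
case: c => a b /=; rewrite sqr_sqrtr ?addr_ge0 ?sqr_ge0//.
by simpc; rewrite -!expr2 [b * a]mulrC addNr.
Qed.

Lemma moment_vecZ k l c (Z : 'cV[C]_k.+1) :
  c != 0 -> moment_vec l (c *: Z) = moment_vec l Z.
Proof.
move=> c0; apply: val_inj => /=; rewrite /moment_mx.
set N := (Normc.normc c ^+ 2)%:C.
have N0 : N != 0.
  by rewrite /N rmorphXn /= expf_neq0// fmorph_eq0 normc_neq0.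
have mulZ (A B : 'cV[C]_k) : (c *: A)^T *m map_mx conjc (c *: B) =
    N *: (A^T *m map_mx conjc B).
  rewrite map_mxZ (_ : (c *: A)^T = c *: A^T); last first.
    by apply/matrixP => i j; rewrite !mxE.
  by rewrite -scalemxAl -scalemxAr scalerA /N normcsqE.
rewrite !(F1Z, F2Z, normsqZ, mulZ) ![l%:~R * _]mulrCA -!mulrDr.
have NM x : (Normc.normc c ^+ 2 * x)%:C = N * x%:C by rewrite rmorphM.
rewrite !NM -!scale_scalar_mx -scale_block_mx.
rewrite -[N *: _]/(N *: (_ : 'M[C]_2)) scalerA; congr (_ *: _).
by rewrite invfM [N^-1 * _]mulrC mulrA mulfVK.
Qed.

Lemma vpick_line (V : vectType C) (v : V) :
  v != 0 -> exists2 c : C, c != 0 & vpick <[v]>%VS = c *: v.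
Proof.
move=> v0; have /vlineP[c e] := memv_pick <[v]>%VS.
exists c => //; apply: contra_neq v0 => c0.
apply/eqP; move/eqP: e; rewrite c0 scale0r vpick0 => /eqP v0.
by rewrite -memv0 -v0 memv_line.
Qed.

Lemma momentE k l (Z : 'cV[C]_k.+1) :
  Z != 0 -> moment l <[Z]>%VS = moment_vec l Z.
Proof.
by move=> /vpick_line[c c0 e]; rewrite /moment e moment_vecZ.
Qed.

Lemma moment_sumE r l k (Z : 'cV[C]_(\sum_(a < r) (k a).+1)) :
  Z != 0 -> moment_sum l <[Z]>%VS = moment_sum_vec l Z.
Proof.
move=> /vpick_line[c c0 e]; rewrite /moment_sum e /moment_sum_vec.
have sZ a : submxcol (c *: Z) a = c *: submxcol Z a.
  by apply/matrixP => i j; rewrite !mxE.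
apply: eq_big => [a|a]; first by rewrite sZ scaler_eq0 (negPf c0).
rewrite sZ scaler_eq0 (negPf c0) /= => Za0.
rewrite !momentE ?scaler_eq0 ?(negPf c0)// moment_vecZ// !normsqZ.
congr (_ *: _); rewrite -mulf_div divff ?mul1r//.
by rewrite expf_neq0// normc_neq0.
Qed.

End MomentMap.

Arguments moment {R} k l L.
Arguments moment_sum {R r} l k L.

Definition generic r (l : 'I_r -> int) (k : 'I_r -> nat) : Prop :=
  forall m : int, (exists a : 'I_r, (l a, k a) = (m, 1%N)) ->
    exists a b : 'I_r,
      [/\ (a < b)%N, (l a, k a) = (m, 1%N) & (l b, k b) = (m, 1%N)].

(* Main.v *)
(* The Gram matrix of (F1 Z, F2 Z) shows that the image of Phi_{k,l} lies in a
   3-ball of radius k/2, inside the affine space of matrices of trace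
   i (k + 2 l). For k <> 1 the image is the whole ball: if (u, v) and (u', v')
   are orthogonal unit vectors of C^2, the k-th powers of these two vectors are
   orthogonal, and so are their (k-1)-th powers when k >= 2, so a combination of
   them realises any prescribed spectral decomposition of the Gram matrix. For
   k = 1 the image is the bounding sphere. The image of Phi_{L,K} consists of
   the convex combinations with one point in each of the images; genericity
   supplies a second copy of each sphere, and a point of the ball is a convex
   combination of two points of the sphere. *)
Require Import Defs.
From mathcomp Require Import all_boot all_order all_algebra.
From mathcomp Require Import all_classical all_reals all_analysis.
From mathcomp Require Import ring lra.

Set Implicit Arguments.
Unset Strict Implicit.
Unset Printing Implicit Defensive.

Import Order.TTheory GRing.Theory Num.Theory.
Local Open Scope classical_set_scope.
Local Open Scope ring_scope.
Local Open Scope complex_scope.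
(* Otherwise [z^*] in [ring_scope] is [Num.conj], only convertible to [conjc]. *)
Local Notation "z ^*" := (conjc z) : ring_scope.

(** * Convex combinations, joins of finite families of sets, convex hulls *)

Section Convexity.
Context {R : realType} {E : lmodType R}.
Implicit Types (A B : set E).

(** Two real weights with sum 1 replace the weight of unit-interval type, so that later side
    conditions are plain arithmetic. *)
Lemma convex_setP A : @convex_set R E A <->
  forall (s t : R) x y, 0 <= s -> 0 <= t -> s + t = 1 -> A x -> A y ->
    A (s *: x + t *: y).
Proof.
split=> [cA s t x y s0 t0 st Ax Ay|cA x y p].
  have s1 : s <= 1 by rewrite -st lerDl.
  have := cA x y (Itv01 s0 s1); rewrite !inE => /(_ Ax Ay).
  by rewrite (_ : t = 1 - s)// -st addrAC subrr add0r.
rewrite !inE => Ax Ay; apply: (cA p%:num (1 - p%:num)) => //.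
by rewrite addrC subrK.
Qed.

(** Induction on a list of indices works once each partial sum is divided by its total weight: the
    normalised sum is again a point of [A]. *)
Lemma convex_set_sum (I : finType) A (t : I -> R) (v : I -> E) :
    @convex_set R E A -> (forall i, 0 <= t i) -> \sum_i t i = 1 ->
    (forall i, A (v i)) -> A (\sum_i t i *: v i).
Proof.
move=> /convex_setP cA t0 t1 Av.
have main (s : seq I) : 0 < \sum_(i <- s) t i ->
    A ((\sum_(i <- s) t i)^-1 *: \sum_(i <- s) t i *: v i).
  elim: s => [|i s IH]; first by rewrite big_nil ltxx.
  rewrite !big_cons; set T := \sum_(j <- s) t j; set w := \sum_(j <- s) _.
  have T0 : 0 <= T by apply: sumr_ge0.
  have [T00|Tn0] := eqVneq T 0.
    have ts j : j \in s -> t j = 0.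
      by move/eqP: T00; rewrite psumr_eq0// => /allP tS /tS /eqP.
    have -> : w = 0 by rewrite /w big_seq big1// => j /ts ->; rewrite scale0r.
    by rewrite T00 !addr0 => ti; rewrite scalerA mulVf ?scale1r ?lt0r_neq0.
  move=> tT; have Tp : 0 < T by rewrite lt0r Tn0.
  have tT0 := lt0r_neq0 tT.
  have -> : (t i + T)^-1 *: (t i *: v i + w) =
      (t i / (t i + T)) *: v i + (T / (t i + T)) *: (T^-1 *: w).
    rewrite scalerDr !scalerA; congr (_ *: _ + _ *: _); first by rewrite mulrC.
    by rewrite mulrAC divff// mul1r.
  apply: cA; rewrite ?divr_ge0 ?(ltW tT) ?t0//; first by rewrite -mulrDl divff.
  exact: IH.
by have := main (index_enum I); rewrite t1 invr1 scale1r; apply.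
Qed.

(** A point of [A a] is demanded even at weight zero, so a single empty [A a] empties the join; this
    is why nonemptiness is assumed in [sub_convex_join]. *)
Definition convex_join (I : finType) (A : I -> set E) : set E :=
  [set x | exists t v, [/\ forall a, 0 <= t a, \sum_a t a = 1,
    forall a, A a (v a) & x = \sum_a t a *: v a]].

Lemma convex_join_convex (I : finType) (A : I -> set E) :
  (forall a, @convex_set R E (A a)) -> @convex_set R E (convex_join A).
Proof.
move=> cA; apply/convex_setP => s1 s2 _ _ s10 s20 s12
  [t1 [v1 [t10 t11 Av1 ->]]] [t2 [v2 [t20 t21 Av2 ->]]].
pose t a := s1 * t1 a + s2 * t2 a.
have u1 a : 0 <= s1 * t1 a by rewrite mulr_ge0.
have u2 a : 0 <= s2 * t2 a by rewrite mulr_ge0.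
(* At index [a] the two old points are mixed in proportion to their new weights. If the total weight
   [t a] is zero, any point of [A a] will do. *)
exists t, (fun a => if t a == 0 then v1 a else
  (s1 * t1 a / t a) *: v1 a + (s2 * t2 a / t a) *: v2 a); split.
- by move=> a; rewrite addr_ge0.
- by rewrite big_split /= -!mulr_sumr t11 t21 !mulr1.
- move=> a; have [//|ta0] := eqVneq (t a) 0.
  have ta : 0 <= t a by rewrite addr_ge0.
  by move/convex_setP: (cA a); apply; rewrite ?divr_ge0// -mulrDl divff.
- rewrite !scaler_sumr -big_split /=; apply: eq_bigr => a _.
  have [/eqP|ta0] := eqVneq (t a) 0.
    rewrite /t paddr_eq0// => /andP[/eqP e1 /eqP e2].
    by rewrite !scalerA e1 e2 add0r !scale0r addr0.
  by rewrite scalerDr !scalerA !(mulrC (t a)) !mulfVK.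
Qed.

Lemma sub_convex_join (I : finType) (A : I -> set E) a :
  (forall b, A b !=set0) -> A a `<=` convex_join A.
Proof.
move=> A0 x Ax; have [y Ay] := choice A0.
exists (fun b => (b == a)%:R), (fun b => if b == a then x else y b); split.
- by move=> b; rewrite ler0n.
- by rewrite (bigD1 a)//= eqxx big1 ?addr0// => b /negPf ->.
- by move=> b; case: eqP => [->|].
- rewrite (bigD1 a)//= !eqxx scale1r big1 ?addr0// => b /negPf ->.
  by rewrite scale0r.
Qed.

(* A point of [B a] outside [A a] is merged with the point of [B b = B a], and
   the resulting point of [B a] is then split between [A a] and [A b]. *)
Lemma convex_join_split (I : finType) (A B : I -> set E) :
    (forall a, A a `<=` B a) -> (forall a, @convex_set R E (B a)) ->
    (forall a, B a `<=` A a \/ exists b, [/\ b != a, B a = B b &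
      forall x, B a x -> exists s t p q,
        [/\ 0 <= s, 0 <= t, s + t = 1, A a p & A b q] /\ x = s *: p + t *: q]) ->
  convex_join B = convex_join A.
Proof.
move=> AB cB BA; apply/seteqP; split; last first.
  by move=> x [t [v [t0 t1 Av ->]]]; exists t, v; split=> // a; apply: AB.
move=> x [t [v [t0 t1 Bv ->]]] {x}.
(* Induction on the number of indices whose point lies outside [A a]. *)
have [n] := ubnP #|[pred a | ~~ `[< A a (v a) >]]|.
elim: n => // n IH in t v t0 t1 Bv *; rewrite ltnS => vn.
have [a /= /asboolPn nAa|Av] := pickP [pred a | ~~ `[< A a (v a) >]]; last first.
  exists t, v; split=> // a; apply: contrapT => /asboolPn nA.
  by have := Av a; rewrite /= nA.
have [/(_ _ (Bv a))//|[b [ba Bab sp]]] := BA a.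
have ab : a != b by rewrite eq_sym.
pose T := t a + t b; have T0 : 0 <= T by rewrite addr_ge0.
have [w Bw Tw] : exists2 w, B a w & T *: w = t a *: v a + t b *: v b.
  have [T00|Tn0] := eqVneq T 0.
    exists (v a) => //; move/eqP: (T00).
    rewrite paddr_eq0// => /andP[/eqP e1 /eqP e2].
    by rewrite T00 e1 e2 !scale0r addr0.
  exists ((t a / T) *: v a + (t b / T) *: v b).
    have /convex_setP := cB a; apply; rewrite ?divr_ge0//.
    - by rewrite -mulrDl divff.
    - by rewrite Bab.
  by rewrite scalerDr !scalerA !(mulrC T) !mulfVK.
have [s [s' [p [q [[s0 s'0 ss Ap Aq] we]]]]] := sp _ Bw.
pose t' c := if c == a then T * s else if c == b then T * s' else t c.
pose v' c := if c == a then p else if c == b then q else v c.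
(* Only the indices [a] and [b] change; this compares both the weight sums and the vector sums. *)
have sumD (V : nmodType) (f g : I -> V) :
    f a + f b = g a + g b -> (forall c, c != a -> c != b -> f c = g c) ->
    \sum_c f c = \sum_c g c.
  move=> e1 e2; rewrite (bigD1 a)// (bigD1 b)//=.
  rewrite [RHS](bigD1 a)// [in RHS](bigD1 b)//=.
  rewrite !addrA e1; congr (_ + _).
  by apply: eq_bigr => c /andP[? ?]; apply: e2.
have -> : \sum_a t a *: v a = \sum_a t' a *: v' a.
  apply: sumD => [|c /negPf ca /negPf cb]; rewrite /t' /v' ?ca ?cb//.
  by rewrite !eqxx (negPf ba) -!scalerA -scalerDr -we Tw.
apply: IH.
- move=> c; rewrite /t'; case: eqP => _; first exact: mulr_ge0.
  by case: eqP => _; first exact: mulr_ge0.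
- rewrite -t1; apply: sumD => [|c /negPf ca /negPf cb]; rewrite /t' ?ca ?cb//.
  by rewrite !eqxx (negPf ba) -mulrDr ss mulr1.
- move=> c; rewrite /v'; case: eqP => [->|_]; first exact: AB.
  by case: eqP => [->|_//]; exact: AB.
(* The index [a] leaves the set of bad indices and none enters it, as [p] and [q] lie in [A a] and
   [A b]. *)
- apply: leq_trans vn; apply: proper_card; apply/fintype.properP; split.
    apply/fintype.subsetP => c; rewrite !inE /v'; case: eqP => [->|_].
      by move/asboolPn.
    by case: eqP => [->|_//] /asboolPn.
  by exists a; rewrite inE ?negbK /v' ?eqxx; apply/asboolP.
Qed.

(** Convexity is assumed of the join only: a sphere is not convex, but its join with a second copy
    of itself is. *)
Lemma convex_hull_bigcup (I : finType) (A : I -> set E) :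
    (forall a, A a !=set0) -> @convex_set R E (convex_join A) ->
  convex_hull (\bigcup_(a in [set: I]) A a) = convex_join A.
Proof.
move=> A0 cA; apply/seteqP; split.
  apply: smallest_sub => // x [a _]; exact: sub_convex_join.
move=> x [t [v [t0 t1 Av ->]]] M [cM AM].
by apply: convex_set_sum => // a; apply: AM; exists a.
Qed.

End Convexity.

(** * The Hermitian product on column vectors and the Cauchy-Schwarz inequality *)

Section HermitianProduct.
Context {R : realType}.
Local Notation C := R[i].
Local Notation normc := Normc.normc.

Definition ip n (X Y : 'cV[C]_n) : C := \sum_i X i 0 * (Y i 0)^*.

Lemma normc_conj (c : C) : (normc c ^+ 2)%:C = c * c^*.
Proof. exact: normcsqE. Qed.

Lemma normsqE n (X : 'cV[C]_n) : (normsq X)%:C = ip X X.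
Proof. by rewrite rmorph_sum; apply: eq_bigr => i _; rewrite /= normc_conj. Qed.

Lemma ip_comb n (a b c d : C) (X Y X' Y' : 'cV[C]_n) :
  ip (a *: X + b *: Y) (c *: X' + d *: Y') =
  a * c^* * ip X X' + a * d^* * ip X Y' + b * c^* * ip Y X' + b * d^* * ip Y Y'.
Proof.
rewrite /ip !mulr_sumr -!big_split; apply: eq_bigr => i _ /=.
by rewrite !mxE rmorphD !rmorphM /=; ring.
Qed.

Lemma ipC n (X Y : 'cV[C]_n) : ip Y X = (ip X Y)^*.
Proof.
by rewrite rmorph_sum; apply: eq_bigr => i _; rewrite /= rmorphM /= conjcK mulrC.
Qed.

Lemma normsq_ge0 n (X : 'cV[C]_n) : 0 <= normsq X.
Proof. by apply: sumr_ge0 => i _; exact: sqr_ge0. Qed.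

Lemma normsq_eq0 n (X : 'cV[C]_n) : (normsq X == 0) = (X == 0).
Proof.
apply/idP/eqP => [|->]; last first.
  by rewrite /normsq big1// => i _; rewrite mxE Normc.normc0 expr0n.
rewrite psumr_eq0 => [/allP X0|i _]; last exact: sqr_ge0.
apply/matrixP => i j; rewrite ord1 mxE; apply: Normc.eq0_normc.
by have /eqP/eqP := X0 i (mem_index_enum i); rewrite sqrf_eq0 => /eqP.
Qed.

Lemma normsq_gt0 n (X : 'cV[C]_n) : (0 < normsq X) = (X != 0).
Proof. by rewrite lt0r normsq_eq0 normsq_ge0 andbT. Qed.

(** For [Y != 0], expand the squared norm of [normsq Y * X - ip X Y * Y], a multiple of the
    component of [X] orthogonal to [Y]. *)
Lemma ip_cauchy_schwarz n (X Y : 'cV[C]_n) :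
  normc (ip X Y) ^+ 2 <= normsq X * normsq Y.
Proof.
have [->|Y0] := eqVneq Y 0.
  rewrite (_ : ip X 0 = 0) ?Normc.normc0 ?expr0n ?mulr_ge0 ?normsq_ge0//.
  by apply: big1 => i _; rewrite mxE rmorph0 mulr0.
have N0 : 0 < normsq Y by rewrite normsq_gt0.
have := normsq_ge0 ((normsq Y)%:C *: X + (- ip X Y) *: Y).
suff -> : normsq ((normsq Y)%:C *: X + (- ip X Y) *: Y) =
    normsq Y * (normsq X * normsq Y - normc (ip X Y) ^+ 2).
  by rewrite pmulr_rge0// subr_ge0.
apply: (@complexI R); rewrite [LHS]normsqE ip_comb conjc_real [ip Y X]ipC.
rewrite -!normsqE rmorphM rmorphB [X in _ * (_ - X)]normc_conj.
rewrite rmorphM rmorphN /=.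
ring.
Qed.

End HermitianProduct.

(** * Bloch coordinates on the skew-Hermitian matrices of fixed trace *)

Section Bloch.
Context {R : realType}.
Local Notation C := R[i].
Local Notation normc := Normc.normc.

Lemma bloch_subproof (tau d : R) (c : C) :
  'i *: (block_mx (tau + d)%:C%:M c%:M c^*%:M (tau - d)%:C%:M : 'M[C]_(1 + 1))
    \is a @skew_hermitian R.
Proof.
rewrite skew_hermitianE linearZ /= map_mxZ.
rewrite [X in X *: _](_ : _ = - 'i); last first.
  by apply/eqP; rewrite eq_complex /= oppr0 !eqxx.
rewrite scaleNr; apply/eqP; congr (- (_ *: _)).
by apply: block_mx_hermitian; rewrite tr_scalar_mx map_scalar_mx /= ?conjcK.
Qed.

(** The real numbers [d], [Re c], [Im c] are affine coordinates on the matrices of trace [2 i tau].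
    In the trace form, [d ^+ 2 + normc c ^+ 2] is half the squared distance to the scalar matrix
    [i tau]. *)
Definition bloch (tau d : R) (c : C) : u2 R := U2 (bloch_subproof tau d c).

Lemma bloch_conv (tau s t d d' : R) (c c' : C) : s + t = 1 ->
  s *: bloch tau d c + t *: bloch tau d' c' =
  bloch tau (s * d + t * d') (s%:C * c + t%:C * c').
Proof.
move=> st; apply: val_inj => /=.
rewrite !scalerA ![_ * 'i]mulrC -!scalerA -scalerDr; congr (_ *: _).
rewrite -[LHS]/((_ : 'M[C]_(1 + 1)) + _).
rewrite -[s%:C *: _]/(s%:C *: (_ : 'M[C]_(1 + 1))).
rewrite -[t%:C *: _]/(t%:C *: (_ : 'M[C]_(1 + 1))).
rewrite !scale_block_mx add_block_mx -[tau in RHS]mul1r -st.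
rewrite !scale_scalar_mx -!raddfD /=.
congr (block_mx _%:M _%:M _%:M _%:M : 'M[C]_(1 + 1)).
- by rewrite -!rmorphM -rmorphD /=; congr (_%:C); ring.
- by rewrite rmorphD !rmorphM /= !oppr0.
- by rewrite -!rmorphM -rmorphD /=; congr (_%:C); ring.
Qed.

Definition bloch_ball (tau rho : R) : set (u2 R) :=
  [set A | exists d c, d ^+ 2 + normc c ^+ 2 <= rho ^+ 2 /\ A = bloch tau d c].

Definition bloch_sphere (tau rho : R) : set (u2 R) :=
  [set A | exists d c, d ^+ 2 + normc c ^+ 2 = rho ^+ 2 /\ A = bloch tau d c].

Lemma normc_sqr (c : C) : normc c ^+ 2 = complex.Re c ^+ 2 + complex.Im c ^+ 2.
Proof. by case: c => a b /=; rewrite sqr_sqrtr ?addr_ge0 ?sqr_ge0. Qed.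

Lemma normc_real_sqr (x : R) : normc x%:C ^+ 2 = x ^+ 2.
Proof. by rewrite normc_sqr /= expr0n addr0. Qed.

Lemma bloch_ball_convex (tau rho : R) :
  @convex_set R (u2 R) (bloch_ball tau rho).
Proof.
apply/convex_setP => s t _ _ s0 t0 st [d [c [dc ->]]] [d' [c' [dc' ->]]].
exists (s * d + t * d'), (s%:C * c + t%:C * c'); split; last exact: bloch_conv.
apply: (@le_trans _ _ (s * (d ^+ 2 + normc c ^+ 2) +
                       t * (d' ^+ 2 + normc c' ^+ 2))).
  have cvx (x y : R) : (s * x + t * y) ^+ 2 <= s * x ^+ 2 + t * y ^+ 2.
    rewrite -subr_ge0 (_ : _ - _ = s * t * (x - y) ^+ 2).
      by rewrite mulr_ge0 ?sqr_ge0// mulr_ge0.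
    by rewrite (_ : t = 1 - s); [ring | rewrite -st addrAC subrr add0r].
  move: c c' {dc dc'} => [x y] [x' y']; rewrite !normc_sqr /=.
  rewrite !mul0r !subr0 !addr0.
  rewrite !mulrDr addrACA lerD// addrACA lerD//.
rewrite -[rho ^+ 2]mul1r -st mulrDl lerD// ler_wpM2l//.
Qed.

(** The chord through the point in the direction of [d] meets the sphere at [(h, c)] and
    [(- h, c)]. *)
Lemma bloch_ball_chord (tau rho : R) A : bloch_ball tau rho A ->
  exists s t p q, [/\ 0 <= s, 0 <= t, s + t = 1,
    bloch_sphere tau rho p & bloch_sphere tau rho q] /\ A = s *: p + t *: q.
Proof.
move=> [d [c [dc ->]]]; pose h := Num.sqrt (rho ^+ 2 - normc c ^+ 2).
have hh : h ^+ 2 = rho ^+ 2 - normc c ^+ 2.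
  by rewrite sqr_sqrtr// subr_ge0 (le_trans _ dc)// lerDr sqr_ge0.
have dh : `|d| <= h.
  by rewrite -ler_sqr ?nnegrE ?sqrtr_ge0// hh real_normK ?num_real// lerBrDr.
(* A chord of length zero forces [d = 0], and the point is already on the sphere. *)
have [h0|hn0] := eqVneq h 0.
  exists 1, 0, (bloch tau d c), (bloch tau d c); split; last first.
    by rewrite scale1r scale0r addr0.
  have S : bloch_sphere tau rho (bloch tau d c).
    exists d, c; split=> //; move: dh hh.
    rewrite h0 normr_le0 => /eqP ->; rewrite !expr0n /= add0r => /eqP.
    by rewrite eq_sym subr_eq0 => /eqP ->.
  by split; rewrite ?addr0.
have h0 : 0 < h by rewrite lt0r hn0 sqrtr_ge0.
have /andP[dl dr] : -1 <= d / h <= 1.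
  by rewrite -ler_norml normrM normfV (gtr0_norm h0) ler_pdivrMr// mul1r.
exists ((1 + d / h) / 2), ((1 - d / h) / 2).
exists (bloch tau h c), (bloch tau (- h) c).
split; first split; [lra | lra | by field | |  |].
- by exists h, c; split=> //; rewrite hh subrK.
- by exists (- h), c; split=> //; rewrite sqrrN hh subrK.
rewrite bloch_conv; last by field.
congr bloch; first by field.
by rewrite -mulrDl -rmorphD (_ : _ + _ = 1 :> R) ?mul1r//; field.
Qed.

(** This is surjectivity of the Hopf map from the 3-sphere to the 2-sphere. A common phase is free,
    so [u] may be real and nonnegative; then [u ^+ 2 = (1 + d) / 2] and [v = c / (2 * u)]. *)
Lemma hopf_surjective (d : R) (c : C) : d ^+ 2 + normc c ^+ 2 = 1 ->
  exists u v : C, [/\ normc u ^+ 2 + normc v ^+ 2 = 1,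
    normc u ^+ 2 - normc v ^+ 2 = d & 2 * (v * u^*) = c].
Proof.
move=> dc; have c0 : 0 <= normc c ^+ 2 by exact: sqr_ge0.
(* At this pole [u] vanishes and the formula for [v] breaks down. *)
have [dN1|dN1] := eqVneq d (-1).
  have {}c0 : c = 0.
    apply: Normc.eq0_normc; apply/eqP; rewrite -sqrf_eq0; apply/eqP.
    by move: dc; rewrite dN1; lra.
  exists 0, 1; rewrite Normc.normc0 Normc.normc1 c0 dN1 conjc0.
  by split; [lra | lra | rewrite !mulr0].
have d1 : 0 < (1 + d) / 2.
  have dge : -1 <= d by nra.
  have : -1 < d by rewrite lt_neqAle eq_sym dN1.
  lra.
pose x := Num.sqrt ((1 + d) / 2).
have x0 : x != 0 by rewrite sqrtr_eq0 -ltNge.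
have xx : x ^+ 2 = (1 + d) / 2 by rewrite sqr_sqrtr// ltW.
have nv : normc (c * (2 * x)^-1%:C) ^+ 2 = (1 - d) / 2.
  rewrite Normc.normcM exprMn normc_real_sqr exprVn exprMn xx.
  have -> : normc c ^+ 2 = (1 - d) * (1 + d).
    by rewrite (_ : normc c ^+ 2 = 1 - d ^+ 2); [ring | lra].
  field; lra.
exists x%:C, (c * (2 * x)^-1%:C); rewrite nv normc_real_sqr xx conjc_real.
split; [lra | lra |].
rewrite -mulrA -rmorphM /= mulrCA -[2]/(2%:R).
rewrite -(rmorph_nat (real_complex R)) -rmorphM /=.
by rewrite (_ : 2 * _ = 1 :> R) ?mulr1//; field.
Qed.

End Bloch.

(** * The moment map of one summand in Bloch coordinates *)

Section MomentImage.
Context {R : realType}.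
Local Notation C := R[i].
Local Notation normc := Normc.normc.

(** The coordinate of index [j] enters the two squared norms with weights [k - j] and [j], which add
    up to [k]. *)
Lemma normsq_F12 k (Z : 'cV[C]_k.+1) :
  normsq (F1 Z) + normsq (F2 Z) = k%:R * normsq Z.
Proof.
have nr (x : R) (z : C) : 0 <= x ->
    normc ((Num.sqrt x)%:C * z) ^+ 2 = x * normc z ^+ 2.
  by move=> x0; rewrite Normc.normcM exprMn normc_real_sqr sqr_sqrtr.
(* The extra index [j = k] has weight zero, as has [j = 0] in the sum for [F2], so both sums run
   over all of ['I_k.+1]. *)
have -> : normsq (F1 Z) = \sum_(j < k.+1) (k - j)%:R * normc (Z j 0) ^+ 2.
  rewrite big_ord_recr /= subnn mul0r addr0.
  by apply: eq_bigr => j _; rewrite mxE nr ?ler0n.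
have -> : normsq (F2 Z) = \sum_(j < k.+1) j%:R * normc (Z j 0) ^+ 2.
  rewrite big_ord_recl /= mul0r add0r.
  by apply: eq_bigr => j _; rewrite mxE nr ?ler0n.
rewrite -big_split mulr_sumr; apply: eq_bigr => j _ /=.
by rewrite -mulrDl -natrD subnK// -ltnS.
Qed.

(** By [normsq_F12] the trace is the constant [i (k + 2 l)], so only the difference of the diagonal
    entries and the off-diagonal entry vary. *)
Lemma moment_vec_bloch k l (Z : 'cV[C]_k.+1) : Z != 0 ->
  moment_vec l Z = bloch (k%:R / 2 + l%:~R)
    ((normsq (F1 Z) - normsq (F2 Z)) / (2 * normsq Z))
    (ip (F2 Z) (F1 Z) * (normsq Z)^-1%:C).
Proof.
move=> Z0; have n0 : normsq Z != 0 by rewrite normsq_eq0.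
have nF := normsq_F12 Z; apply: val_inj => /=; rewrite /moment_mx.
have ipE (X Y : 'cV[C]_k) : X^T *m map_mx conjc Y = (ip X Y)%:M.
  apply/matrixP => i j; rewrite !ord1 !mxE /= mulr1n.
  by apply: eq_bigr => m _; rewrite !mxE.
rewrite !ipE -scalerA; congr (_ *: _).
rewrite -[_^-1 *: _]/(_^-1 *: (_ : 'M[C]_(1 + 1))) scale_block_mx.
rewrite !scale_scalar_mx.
congr (block_mx _%:M _%:M _%:M _%:M : 'M[C]_(1 + 1)).
- rewrite -fmorphV -rmorphM /=; congr (_%:C).
  have -> : normsq (F1 Z) = k%:R * normsq Z - normsq (F2 Z) by rewrite -nF addrK.
  by field.
- by rewrite mulrC -fmorphV.
- by rewrite [ip (F1 Z) _]ipC rmorphM [X in _ = _ * X]conjc_real mulrC -fmorphV.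
- rewrite -fmorphV -rmorphM /=; congr (_%:C).
  have -> : normsq (F1 Z) = k%:R * normsq Z - normsq (F2 Z) by rewrite -nF addrK.
  by field.
Qed.

(** The squared radius minus the squared distance to the centre is the Gram determinant of [F1 Z]
    and [F2 Z] over [normsq Z ^+ 2], nonnegative by Cauchy-Schwarz. *)
Lemma moment_vec_ball k l (Z : 'cV[C]_k.+1) : Z != 0 ->
  bloch_ball (k%:R / 2 + l%:~R) (k%:R / 2) (moment_vec l Z).
Proof.
move=> Z0; rewrite moment_vec_bloch//; eexists; eexists; split; last by [].
have n0 : 0 < normsq Z by rewrite normsq_gt0.
rewrite Normc.normcM [(normc _ * _) ^+ 2]exprMn normc_real_sqr.
have -> : k%:R / 2 = (normsq (F1 Z) + normsq (F2 Z)) / (2 * normsq Z).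
  by rewrite normsq_F12; field; rewrite lt0r_neq0.
have := ip_cauchy_schwarz (F2 Z) (F1 Z).
set a := normsq (F1 Z); set b := normsq (F2 Z); set n := normsq Z.
rewrite -subr_ge0 => ab; rewrite -subr_ge0.
rewrite (_ : _ - _ = (b * a - normc (ip (F2 Z) (F1 Z)) ^+ 2) / n ^+ 2).
  by rewrite divr_ge0 ?sqr_ge0.
by field; rewrite lt0r_neq0.
Qed.

(* [(u, v)^k] in [Sym^k(C^2)], in an orthonormal basis of weight vectors. *)
Definition coherent k (u v : C) : 'cV[C]_k.+1 :=
  \col_(j < k.+1) ((Num.sqrt 'C(k, j)%:R)%:C * (u ^+ (k - j) * v ^+ j)).

(** This is the binomial theorem. Powers of orthogonal vectors are thus orthogonal, except for
    [k = 0]. *)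
Lemma ip_coherent k (u v u' v' : C) :
  ip (coherent k u v) (coherent k u' v') = (u * u'^* + v * v'^*) ^+ k.
Proof.
rewrite exprDn; apply: eq_bigr => j _; rewrite !mxE.
rewrite !rmorphM [X in _ * (X * _) = _]conjc_real !rmorphXn /=.
have s2 : (Num.sqrt 'C(k, j)%:R)%:C * (Num.sqrt 'C(k, j)%:R)%:C = 'C(k, j)%:R :> C.
  by rewrite -rmorphM -expr2 sqr_sqrtr ?ler0n// rmorph_nat.
by rewrite mulrACA s2 mulr_natl mulrACA !exprMn.
Qed.

(** [F1] and [F2] act as normalised partial derivatives on a power of a linear form; the
    coefficients match by [(k + 1 - j) C(k + 1, j) = (k + 1) C(k, j)] here and [(j + 1) C(k + 1, j +
    1) = (k + 1) C(k, j)] for [F2]. *)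
Lemma F1_coherent k (u v : C) :
  F1 (coherent k.+1 u v) = ((Num.sqrt k.+1%:R)%:C * u) *: coherent k u v.
Proof.
apply/matrixP => j i; rewrite !mxE /= -mulrA mulrA -rmorphM -sqrtrM ?ler0n//.
rewrite -natrM -mul_bin_down natrM sqrtrM ?ler0n// rmorphM /= subSn -1?ltnS// exprS.
by ring.
Qed.

Lemma F2_coherent k (u v : C) :
  F2 (coherent k.+1 u v) = ((Num.sqrt k.+1%:R)%:C * v) *: coherent k u v.
Proof.
apply/matrixP => j i; rewrite !mxE /= -mulrA mulrA -rmorphM -sqrtrM ?ler0n//.
rewrite /bump leq0n add1n -natrM -mul_bin_diag natrM sqrtrM ?ler0n//.
rewrite rmorphM /= subSS exprS.
by ring.
Qed.

Lemma F1D k (X Y : 'cV[C]_k.+1) : F1 (X + Y) = F1 X + F1 Y.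
Proof. by apply/matrixP => i j; rewrite !mxE mulrDr. Qed.

Lemma F2D k (X Y : 'cV[C]_k.+1) : F2 (X + Y) = F2 X + F2 Y.
Proof. by apply/matrixP => i j; rewrite !mxE mulrDr. Qed.

(* The Gram matrix of [F1 Z] and [F2 Z] has eigenvalues [k.+1 * p ^+ 2] and
   [k.+1 * q ^+ 2], with eigenvectors [(u, v)] and its orthogonal. *)
Lemma moment_vec_coherent k l (p q : R) (u v : C) :
    p ^+ 2 + q ^+ 2 = 1 -> normc u ^+ 2 + normc v ^+ 2 = 1 ->
    (0 < k)%N || (q == 0) ->
  let Z := p%:C *: coherent k.+1 u v + q%:C *: coherent k.+1 (- v^*) u^* in
  Z != 0 /\ moment_vec l Z = bloch (k.+1%:R / 2 + l%:~R)
    (k.+1%:R / 2 * (p ^+ 2 - q ^+ 2) * (normc u ^+ 2 - normc v ^+ 2))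
    ((k.+1%:R * (p ^+ 2 - q ^+ 2))%:C * (v * u^*)).
Proof.
move=> pq uv kq Z.
have uvC : u * u^* + v * v^* = 1.
  by rewrite -!normc_conj -rmorphD uv rmorph1.
have sw m : ip (coherent m u v) (coherent m u v) = 1 by rewrite ip_coherent uvC expr1n.
have sw' m : ip (coherent m (- v^*) u^*) (coherent m (- v^*) u^*) = 1.
  rewrite ip_coherent rmorphN /= !conjcK mulrNN addrC mulrC [_ * v]mulrC uvC expr1n//.
have cross m : ip (coherent m u v) (coherent m (- v^*) u^*) = 0 ^+ m.
  by rewrite ip_coherent rmorphN /= !conjcK mulrN addrC mulrC subrr.
have cross' m : ip (coherent m (- v^*) u^*) (coherent m u v) = 0 ^+ m.
  by rewrite ipC cross rmorphXn rmorph0.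
(* Every cross term below carries this factor. Orthogonality kills it for [k > 0]; since
   [0 ^+ 0 = 1], the case [k = 0] relies on [q = 0]. *)
have q0 : q%:C * 0 ^+ k = 0 :> C.
  case/orP: kq => [|/eqP ->]; last by rewrite mul0r.
  by case: k Z => // k Z _; rewrite exprS mul0r mulr0.
have nZ : normsq Z = 1.
  apply: (@complexI R); rewrite normsqE /Z ip_comb !conjc_real.
  rewrite sw sw' cross cross' exprS !mul0r !mulr0 !addr0 !mulr1 -!expr2.
  by rewrite -!rmorphXn -rmorphD /= pq.
have Z0 : Z != 0 by rewrite -normsq_gt0 nZ ltr01.
split=> //; rewrite moment_vec_bloch// nZ mulr1 invr1 mulr1.
pose s := (Num.sqrt k.+1%:R : R).
have ss : s%:C * s%:C = k.+1%:R%:C :> C by rewrite -rmorphM -expr2 sqr_sqrtr.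
pose w := coherent k u v; pose w' := coherent k (- v^*) u^*.
have F1Z' : F1 Z =
    (p%:C * (s%:C * u)) *: w + (q%:C * (s%:C * - v^*)) *: w'.
  by rewrite /Z F1D !F1Z !F1_coherent !scalerA.
have F2Z' : F2 Z =
    (p%:C * (s%:C * v)) *: w + (q%:C * (s%:C * u^*)) *: w'.
  by rewrite /Z F2D !F2Z !F2_coherent !scalerA.
have cJ (x : R) (a : C) : (x%:C * a)^* = x%:C * a^*.
  by rewrite rmorphM [X in X * _]conjc_real.
have ipF (a b c d : C) :
    ip ((p%:C * (s%:C * a)) *: w + (q%:C * (s%:C * b)) *: w')
       ((p%:C * (s%:C * c)) *: w + (q%:C * (s%:C * d)) *: w') =
   k.+1%:R%:C * (p%:C ^+ 2 * (a * c^*) + q%:C ^+ 2 * (b * d^*)).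
  rewrite ip_comb sw sw' cross cross' -ss !cJ.
  transitivity (s%:C * s%:C * (p%:C ^+ 2 * (a * c^*) + q%:C ^+ 2 * (b * d^*) +
    p%:C * (a * d^* + b * c^*) * (q%:C * 0 ^+ k))); first ring.
  by rewrite q0 mulr0 addr0.
have nF1 : normsq (F1 Z) =
    k.+1%:R * (p ^+ 2 * normc u ^+ 2 + q ^+ 2 * normc v ^+ 2).
  apply: (@complexI R); rewrite normsqE F1Z' ipF.
  rewrite rmorphM rmorphD (rmorphM _ (p ^+ 2)) (rmorphM _ (q ^+ 2)).
  rewrite [X in _ = _ * (_ * X + _)]normc_conj.
  rewrite [X in _ = _ * (_ + _ * X)]normc_conj.
  by rewrite !rmorphXn rmorphN /= conjcK; ring.
have nF2 : normsq (F2 Z) =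
    k.+1%:R * (p ^+ 2 * normc v ^+ 2 + q ^+ 2 * normc u ^+ 2).
  apply: (@complexI R); rewrite normsqE F2Z' ipF.
  rewrite rmorphM rmorphD (rmorphM _ (p ^+ 2)) (rmorphM _ (q ^+ 2)).
  rewrite [X in _ = _ * (_ * X + _)]normc_conj.
  rewrite [X in _ = _ * (_ + _ * X)]normc_conj.
  by rewrite !rmorphXn /= conjcK; ring.
congr bloch; first by rewrite nF1 nF2; field.
rewrite F1Z' F2Z' ipF rmorphM rmorphB !rmorphXn rmorphN /= conjcK; ring.
Qed.

End MomentImage.

(** * Images of projective spaces, for one summand and for the direct sum *)

Lemma vpick_projective (K : fieldType) (V : vectType K) (L : {vspace V}) :
  projective_space V L -> vpick L != 0.
Proof. by rewrite /projective_space /= vpick0 -dimv_eq0 => /eqP ->. Qed.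

Section ProjectiveImages.
Context {R : realType}.
Local Notation C := R[i].
Local Notation normc := Normc.normc.

Definition moment_image k (l : int) : set (u2 R) :=
  moment k l @` projective_space 'cV[C]_k.+1.

Lemma moment_vec_image k l (Z : 'cV[C]_k.+1) :
  Z != 0 -> moment_image k l (moment_vec l Z).
Proof. by move=> Z0; exists <[Z]>%VS; [exact: vline_projective | exact: momentE]. Qed.

Lemma col_const1_neq0 k : const_mx 1 != 0 :> 'cV[C]_k.+1.
Proof. by apply/eqP => /matrixP/(_ 0 0)/eqP; rewrite !mxE oner_eq0. Qed.

Lemma moment_image_nonempty k l : moment_image k l !=set0.
Proof. by eexists; apply: moment_vec_image (col_const1_neq0 k). Qed.

Lemma moment_image_sub_ball k l :
  moment_image k l `<=` bloch_ball (k%:R / 2 + l%:~R) (k%:R / 2).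
Proof. by move=> _ [L /vpick_projective L0 <-]; exact: moment_vec_ball. Qed.

(** The direction of the point from the centre fixes [(u, v)] through the Hopf map; its distance
    [rho] fixes the coefficients [p] and [q]. *)
Lemma bloch_moment_image k l (d : R) (c : C) :
    d ^+ 2 + normc c ^+ 2 <= (k%:R / 2) ^+ 2 ->
    k != 1 \/ d ^+ 2 + normc c ^+ 2 = (k%:R / 2) ^+ 2 ->
  moment_image k l (bloch (k%:R / 2 + l%:~R) d c).
Proof.
case: k => [|k] dc kdc.
  (* For [k = 0] the ball has radius zero, so any one point of the image is its centre. *)
  have zero (x : R) (z : C) :
      x ^+ 2 + normc z ^+ 2 <= (0%:R / 2) ^+ 2 -> x = 0 /\ z = 0.
    rewrite mul0r expr0n /= => xz.
    have /eqP : x ^+ 2 + normc z ^+ 2 = 0.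
      by apply/eqP; rewrite eq_le xz addr_ge0 ?sqr_ge0.
    rewrite paddr_eq0 ?sqr_ge0// !sqrf_eq0 => /andP[/eqP -> /eqP z0].
    by split=> //; exact: Normc.eq0_normc.
  have [d' [c' [/zero[d'0 c'0] e]]] := moment_vec_ball l (col_const1_neq0 0).
  have [-> ->] := zero _ _ dc.
  rewrite -[X in bloch _ X]d'0 -[X in bloch _ _ X]c'0 -e.
  exact/moment_vec_image/col_const1_neq0.
set n : R := k.+1%:R in dc kdc *; have n0 : 0 < n by rewrite ltr0n.
pose rho := Num.sqrt (d ^+ 2 + normc c ^+ 2).
have rr : rho ^+ 2 = d ^+ 2 + normc c ^+ 2.
  by rewrite sqr_sqrtr ?addr_ge0 ?sqr_ge0.
have r0 : 0 <= rho by exact: sqrtr_ge0.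
have rn : rho <= n / 2 by rewrite -ler_sqr ?nnegrE ?divr_ge0 ?(ltW n0)// rr.
have [u [v [uv duv cuv]]] : exists u v : C, [/\ normc u ^+ 2 + normc v ^+ 2 = 1,
    rho * (normc u ^+ 2 - normc v ^+ 2) = d & rho%:C * (2 * (v * u^*)) = c].
  have [rho0|rho0] := eqVneq rho 0.
    move: rr; rewrite rho0 expr0n /= => /esym/eqP.
    rewrite paddr_eq0 ?sqr_ge0// !sqrf_eq0 => /andP[/eqP -> /eqP/Normc.eq0_normc ->].
    exists 1, 0; rewrite Normc.normc0 Normc.normc1 !mul0r.
    by split=> //; ring.
  have [|u [v [uv duv cuv]]] := @hopf_surjective R (d / rho) (c * rho^-1%:C).
    rewrite Normc.normcM [(normc _ * _) ^+ 2]exprMn normc_real_sqr.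
    by rewrite expr_div_n exprVn -mulrDl -rr divff ?expf_neq0.
  exists u, v; rewrite duv cuv; split=> //; first by rewrite mulrC divfK.
  by rewrite mulrCA -rmorphM divff// mulr1.
(* These solve [p ^+ 2 + q ^+ 2 = 1] and [n / 2 * (p ^+ 2 - q ^+ 2) = rho]. *)
pose p := Num.sqrt (1 / 2 + rho / n); pose q := Num.sqrt (1 / 2 - rho / n).
have rn2 : rho / n <= 1 / 2 by rewrite ler_pdivrMr// mulrAC mul1r.
have rn0 : 0 <= rho / n by rewrite divr_ge0// ltW.
have pp : p ^+ 2 = 1 / 2 + rho / n by rewrite sqr_sqrtr// addr_ge0// divr_ge0.
have qq : q ^+ 2 = 1 / 2 - rho / n by rewrite sqr_sqrtr// subr_ge0.
have [||Z0 e] := @moment_vec_coherent R k l p q u v _ uv.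
- by rewrite pp qq; field; rewrite lt0r_neq0.
(* On the bounding sphere [rho = n / 2], hence [q = 0]. *)
- case: kdc => [k1|e]; first by rewrite lt0n -eqSS k1.
  apply/orP; right; rewrite -sqrf_eq0 qq.
  have -> : rho = n / 2.
    by apply/eqP; rewrite -(@eqrXn2 _ 2)// ?divr_ge0 ?ltW// rr e.
  by apply/eqP; field; rewrite lt0r_neq0.
move: e; rewrite pp qq -/n.
have -> : 1 / 2 + rho / n - (1 / 2 - rho / n) = 2 * rho / n.
  by field; rewrite lt0r_neq0.
rewrite (_ : n / 2 * _ = rho) ?duv; last by field; rewrite lt0r_neq0.
rewrite (_ : n * _ = rho * 2) ?rmorphM ?rmorph_nat -?mulrA ?cuv; last first.
  by field; rewrite lt0r_neq0.
by move=> <-; exact: moment_vec_image.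
Qed.

Lemma ball_sub_moment_image k l : k != 1 ->
  bloch_ball (k%:R / 2 + l%:~R) (k%:R / 2) `<=` moment_image k l.
Proof. by move=> k1 _ [d [c [dc ->]]]; apply: bloch_moment_image => //; left. Qed.

Lemma sphere_sub_moment_image k l :
  bloch_sphere (k%:R / 2 + l%:~R) (k%:R / 2) `<=` moment_image k l.
Proof.
by move=> _ [d [c [dc ->]]]; apply: bloch_moment_image; [rewrite dc | right].
Qed.

Lemma normsq_submxcol r (p : 'I_r -> nat) (Z : 'cV[C]_(\sum_a p a)) :
  normsq Z = \sum_a normsq (submxcol Z a).
Proof.
rewrite /normsq sig_big_dep /= (reindex _ tagnat.sig_bij_on) /=.
by apply: eq_bigr => i _; rewrite -{1}(submxcolK Z) mxE.
Qed.

(** Scaling a unit representative by [Num.sqrt t] gives a block whose squared norm is exactly the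
    prescribed weight [t]. *)
Lemma moment_image_unit k l A : moment_image k l A ->
  exists2 Y : 'cV[C]_k.+1, normsq Y = 1 & A = moment_vec l Y.
Proof.
move=> [L /vpick_projective L0 <-]; rewrite /moment; set Y := vpick L in L0 *.
have Y0 : 0 < normsq Y by rewrite normsq_gt0.
exists ((Num.sqrt (normsq Y))^-1%:C *: Y).
  rewrite normsqZ normc_real_sqr exprVn sqr_sqrtr ?ltW//.
  by rewrite mulVf ?lt0r_neq0.
by rewrite moment_vecZ// fmorph_eq0 invr_eq0 sqrtr_eq0 -ltNge.
Qed.

(** The blocks of [Z] vary independently: their squared norms realise any weights of sum 1, and
    their directions any choice of one point per image. *)
Lemma moment_sum_image r (l : 'I_r -> int) (k : 'I_r -> nat) :
  moment_sum l k @` projective_space 'cV[C]_(\sum_(a < r) (k a).+1) =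
  convex_join (fun a => moment_image (k a) (l a)).
Proof.
apply/seteqP; split=> [_ [L /vpick_projective L0 <-]|].
  rewrite /moment_sum; set Z := vpick L in L0 *.
  have Z0 : 0 < normsq Z by rewrite normsq_gt0.
  (* A zero block has weight zero but still owes a point of its image; the all-ones vector supplies
     it. *)
  exists (fun a => normsq (submxcol Z a) / normsq Z), (fun a =>
    if submxcol Z a != 0 then moment (k a) (l a) <[submxcol Z a]>%VS
    else moment_vec (l a) (const_mx 1 : 'cV[C]_(k a).+1)); split.
  - by move=> a; rewrite divr_ge0 ?normsq_ge0.
  - by rewrite -mulr_suml -normsq_submxcol divff ?lt0r_neq0.
  - move=> a; case: ifPn => [Za0|_].
      by rewrite momentE//; exact: moment_vec_image.
    exact/moment_vec_image/col_const1_neq0.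
  - rewrite /moment_sum_vec big_mkcond; apply: eq_bigr => a _.
    case: ifPn => // /negPn Za0.
    by move: (Za0); rewrite -normsq_eq0 => /eqP ->; rewrite mul0r scale0r.
move=> _ [t [v [t0 t1 Av ->]]].
pose Y a := s2val (cid2 (moment_image_unit (Av a))).
have Y1 a : normsq (Y a) = 1 := s2valP (cid2 (moment_image_unit (Av a))).
have vY a : v a = moment_vec (l a) (Y a) :=
  s2valP' (cid2 (moment_image_unit (Av a))).
pose Z := \mxcol_a ((Num.sqrt (t a))%:C *: Y a).
have sZ a : submxcol Z a = (Num.sqrt (t a))%:C *: Y a by rewrite /Z mxcolK.
have nZa a : normsq (submxcol Z a) = t a.
  by rewrite sZ normsqZ normc_real_sqr sqr_sqrtr// Y1 mulr1.
have nZ : normsq Z = 1.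
  by rewrite normsq_submxcol -[RHS]t1; apply: eq_bigr => a _; exact: nZa.
have Z0 : Z != 0 by rewrite -normsq_gt0 nZ ltr01.
exists <[Z]>%VS; first exact: vline_projective.
rewrite moment_sumE// /moment_sum_vec nZ big_mkcond; apply: eq_bigr => a _.
rewrite -normsq_eq0 nZa divr1.
case: eqVneq => [->|ta0] /=; first by rewrite scale0r.
rewrite momentE; last by rewrite -normsq_eq0 nZa.
by rewrite sZ moment_vecZ ?vY// fmorph_eq0 sqrtr_eq0 -ltNge lt0r ta0 /=.
Qed.

End ProjectiveImages.

Theorem proposition2p3 (R : realType) (r : nat) (l : 'I_r -> int)
    (k : 'I_r -> nat) (r_ge1 : (1 <= r)%N) (W_generic : generic l k) :
  moment_sum l k @` projective_space 'cV[R[i]]_(\sum_(a < r) (k a).+1) =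
  convex_hull
    (\bigcup_(a in [set: 'I_r])
       (moment (k a) (l a) @` projective_space 'cV[R[i]]_(k a).+1)).
Proof.
rewrite moment_sum_image.
pose B a := @bloch_ball R ((k a)%:R / 2 + (l a)%:~R) ((k a)%:R / 2).
(* Filling each image up to its ball does not change the join; only the indices with [k a = 1] need
   a partner. *)
have BA : convex_join B = convex_join (fun a => moment_image (k a) (l a)).
  apply: convex_join_split => a; first exact: moment_image_sub_ball.
    exact: bloch_ball_convex.
  have [k1|k1] := eqVneq (k a) 1%N; last by left; exact: ball_sub_moment_image.
  right; have [|a1 [b1 [ab ha hb]]] := W_generic (l a).
    by exists a; rewrite k1.
  (* Of the two distinct indices given by genericity, at least one differs from [a]. *)
  have [b [ba [lb kb]]] : exists b, b != a /\ (l b, k b) = (l a, k a).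
    rewrite k1; have [aa1|aa1] := eqVneq a1 a; last by exists a1.
    by exists b1; split=> //; rewrite -aa1 neq_ltn ab orbT.
  exists b; split; rewrite /B ?lb ?kb// => x /bloch_ball_chord.
  move=> [s [t [p [q [[s0 t0 st Sp Sq] ->]]]]]; exists s, t, p, q; split=> //.
  by split=> //; rewrite -?lb -?kb; apply: sphere_sub_moment_image;
    rewrite ?lb ?kb.
rewrite -[RHS]/(convex_hull
  (\bigcup_(a in [set: 'I_r]) moment_image (k a) (l a))).
rewrite convex_hull_bigcup// => [a|]; first exact: moment_image_nonempty.
by rewrite -BA; apply: convex_join_convex => a; exact: bloch_ball_convex.
Qed.
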